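(* Let $d\in\mathbb{N}$ and let $T=(T_1,\ldots,T_d)$ be a fully coisometric, commuting row contraction over a Hilbert space $\mathcal{H}$. Then $T$ is spherical if and only if $$\lim_{\ell\to\infty}\bigl\|(p_\ell\otimes I_{\mathcal{H}})(\eta\otimes\widetilde{T}_{\ell-m}^*h)\bigr\|_{E^{\circledS\ell}\otimes\mathcal{H}}=\|T_m(\eta)h\|_{\mathcal{H}}$$ for all $m\in\mathbb{N}$, $\eta\in E^{\circledS m}$ and $h\in\mathcal{H}$, where $E=\mathbb{C}^d$ and (here and in the context) $T_m(\eta)$ with an argument $\eta\in E^{\circledS m}$ denotes the value of the $m$-th map of the associated covariant representation.
   Context: Let $E=\mathbb{C}^d$ with a fixed orthonormal basis $e_1,\ldots,e_d$. For $n\in\mathbb{N}$ let $p_n$ be the projection on $E^{\otimes n}$ given by $p_n(f_1\otimes\cdots\otimes f_n)=\frac{1}{n!}\sum_\pi f_{\pi(1)}\otimes\cdots\otimes f_{\pi(n)}$, the sum being over all permutations $\pi$ of $\{1,\ldots,n\}$. Put $E^{\circledS n}:=p_nE^{\otimes n}$ (the symmetric tensor power) and $E^{\circledS 0}:=\mathbb{C}$. The family $(E^{\circledS n})_{n\in\mathbb{Z}_+}$ is the symmetric subproduct system; note $E^{\circledS(n+m)}\subseteq E^{\circledS n}\otimes E^{\circledS m}$. A commuting row contraction of length $d$ over $\mathcal{H}$ is a tuple $(T_1,\ldots,T_d)$ of commuting operators in $B(\mathcal{H})$ with $\sum_iT_iT_i^*\le I_{\mathcal{H}}$. It is identified with the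 completely contractive, covariant representation of the symmetric subproduct system, i.e. the family of linear maps $T_n:E^{\circledS n}\to B(\mathcal{H})$, $n\in\mathbb{Z}_+$, determined by $T_0(c)=cI_{\mathcal{H}}$ and $T_n(p_n(e_{i_1}\otimes\cdots\otimes e_{i_n}))=T_{i_1}\cdots T_{i_n}$ (so $T_1(e_i)=T_i$). The map $\widetilde{T}_n:E^{\circledS n}\otimes\mathcal{H}\to\mathcal{H}$ is the contraction $\widetilde{T}_n(\zeta\otimes h)=T_n(\zeta)h$. $T$ is fully coisometric if $\widetilde{T}_n$ is coisometric for every $n$; equivalently $\sum_iT_iT_i^*=I_{\mathcal{H}}$. For $\ell\ge m$, $\eta\otimes\widetilde{T}_{\ell-m}^*h$ is an element of $E^{\circledS m}\otimes E^{\circledS(\ell-m)}\otimes\mathcal{H}\subseteq E^{\otimes\ell}\otimes\mathcal{H}$. A commuting row contraction $T$ is spherical if every $T_i$ is normal and $T_1T_1^*+\cdots+T_dT_d^*=I_{\mathcal{H}}$. *)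

(* Defs.v *)
From HB Require Import structures.
From mathcomp Require Import all_boot all_order all_algebra all_fingroup.
From mathcomp Require Import sesquilinear complex.
From mathcomp Require Import all_classical all_reals all_analysis.
Set Implicit Arguments.
Unset Strict Implicit.
Unset Printing Implicit Defensive.
Import Order.TTheory GRing.Theory Num.Theory Num.Def.
Import numFieldNormedType.Exports.
Local Open Scope classical_set_scope.
Local Open Scope ring_scope.

(* Inner products are the library's forms {dot V for conjC}; they are linear
   in the first argument. *)

Section InnerProduct.
Variable R : realType.
Local Notation C := R[i].

(* A Hilbert space is a completeNormedModType over C whose norm is the one of
   the given inner product. *)
Definition hilbert_dot (H : completeNormedModType C) (f : {dot H for conjC}) :=
  forall x : H, `|x| ^+ 2 = f x x.

(* The norm of an inner product, with values in R rather than in C. *)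
Definition dnorm (V : lmodType C) (f : {dot V for conjC}) (x : V) : R :=
  Num.sqrt (complex.Re (f x x)).

(* The adjoint W -> D of the restriction of A : V -> W to a subspace D of V.
   The point chosen is unique, and it exists as soon as D and W are Hilbert
   spaces and A is bounded on D (Riesz). *)
Definition adjoint_on (V W : lmodType C) (fV : {dot V for conjC})
    (fW : {dot W for conjC}) (D : set V) (A : V -> W) (y : W) : V :=
  xget 0 [set x | D x /\ forall v, D v -> fW (A v) y = fV v x].

Definition adjoint (V : lmodType C) (f : {dot V for conjC}) (A : V -> V) :=
  adjoint_on f f setT A.

End InnerProduct.

(* With E = C^d and its basis (e_i), E^{(x)n} (x) V is identified with the
   families in V indexed by the words w = (w_1, ..., w_n) in {1, ..., d}:
   the family F stands for \sum_w e_{w_1} (x) ... (x) e_{w_n} (x) F w.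
   The space E^{(x)n} itself is the case V = C. *)
Notation tpow d n V := {ffun {ffun 'I_n -> 'I_d} -> V}.

Section TensorPowers.
Variables (R : realType) (d : nat).
Local Notation C := R[i].

(* p_n (x) I_V *)
Definition symproj n (V : lmodType C) (F : tpow d n V) : tpow d n V :=
  [ffun w : {ffun 'I_n -> 'I_d} => (n`!%:R : C)^-1 *:
     \sum_(s : 'S_n) F [ffun i => w (s i)]].

(* The symmetric tensor power, tensored with V. *)
Definition sympow n (V : lmodType C) : set (tpow d n V) :=
  range (@symproj n V).

Definition tensor m k (V : lmodType C) (eta : tpow d m C^o) (G : tpow d k V) :
    tpow d (m + k) V :=
  [ffun w : {ffun 'I_(m + k) -> 'I_d} =>
     eta [ffun i => w (lshift k i)] *: G [ffun j => w (rshift m j)]].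

(* f_1 (x) ... (x) f_n *)
Definition pure_tensor n (f : 'I_n -> 'rV[C]_d) : tpow d n C^o :=
  [ffun w : {ffun 'I_n -> 'I_d} => \prod_i f i 0 (w i)].

Lemma symproj_pure n (f : 'I_n -> 'rV[C]_d) :
  symproj (pure_tensor f) =
  (n`!%:R : C)^-1 *: \sum_(s : 'S_n) pure_tensor (f \o s).
Proof.
apply/ffunP=> w; rewrite !ffunE sum_ffunE; congr (_ *: _).
rewrite (reindex_inj invg_inj) /=; apply: eq_bigr => s _; rewrite !ffunE.
rewrite (reindex_inj (@perm_inj _ s)) /=; apply: eq_bigr => i _.
by rewrite ffunE permK.
Qed.

Section Dot.
Variables (V : lmodType C) (f : {dot V for conjC}) (n : nat).

Definition tdot (F G : tpow d n V) : C := \sum_w f (F w) (G w).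

Let tdot_bilinear :
  bilinear_for (GRing.Scale.Law.clone _ _ *%R _)
    (GRing.Scale.Law.clone _ _ (conjC \; *%R) _) tdot.
Proof.
split=> [G a F1 F2 | F a G1 G2]; rewrite /= /tdot mulr_sumr -big_split /=;
  apply: eq_bigr => w _; rewrite !ffunE.
- by rewrite linearPl.
- by rewrite linearPr.
Qed.

HB.instance Definition _ :=
  bilinear_isBilinear.Build C (tpow d n V) (tpow d n V) C _ _ tdot tdot_bilinear.

Let tdot_herm (F G : tpow d n V) : tdot F G = (-1) ^+ false * (tdot G F)^*.
Proof.
rewrite expr0 mul1r /tdot rmorph_sum; apply: eq_bigr => w _ /=.
by rewrite hermC expr0 mul1r.
Qed.

HB.instance Definition _ :=
  isHermitianSesquilinear.Build C (tpow d n V) false conjC tdot tdot_herm.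

Let tdot_gt0 (F : tpow d n V) : F != 0 -> 0 < tdot F F.
Proof.
move=> F0; rewrite lt_def /tdot sumr_ge0 ?andbT; last by move=> w _; exact: dnorm_ge0.
rewrite psumr_eq0; last by move=> w _; exact: dnorm_ge0.
apply: contra F0 => /allP F0; apply/eqP/ffunP => w; rewrite ffunE.
by apply/eqP; rewrite -(dnorm_eq0 f); apply: F0; rewrite mem_index_enum.
Qed.

HB.instance Definition _ :=
  isDotProduct.Build C (tpow d n V) tdot tdot_gt0.

End Dot.
End TensorPowers.

Section RowContractions.
Variables (R : realType) (d : nat) (H : completeNormedModType R[i]).
Variables (f : {dot H for conjC}) (T : 'I_d -> {linear H -> H}).
Local Notation C := R[i].

(* Continuity is with respect to the norm topology of H, i.e. T i is in B(H). *)
Definition commuting_row_contraction : Prop :=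
  [/\ forall i, continuous (T i),
      forall i j h, T i (T j h) = T j (T i h) &
      forall h, f (\sum_i T i (adjoint f (T i) h)) h <= f h h].

(* T_{w_1} ... T_{w_n} *)
Definition wordop n (w : {ffun 'I_n -> 'I_d}) (h : H) : H :=
  foldr (fun i x => T i x) h [seq w i | i <- enum 'I_n].

(* T_n(zeta), for zeta in the n-th symmetric power: the linear map which sends
   the projection p_n(e_{w_1} (x) ... (x) e_{w_n}) to T_{w_1} ... T_{w_n}
   (rep_symproj_basis below). *)
Definition rep n (zeta : tpow d n C^o) (h : H) : H :=
  \sum_w zeta w *: wordop w h.

(* The operator induced by zeta (x) h |-> T_n(zeta) h (rep_tilde_tensor below).
   It only matters on the symmetric power. *)
Definition rep_tilde n (F : tpow d n H) : H := \sum_w wordop w (F w).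

Definition rep_tilde_adj n : H -> tpow d n H :=
  adjoint_on (tdot (d := d) f (n := n)) f (sympow (n := n) (V := H))
    (rep_tilde (n := n)).

Definition fully_coisometric : Prop :=
  forall n h, rep_tilde (rep_tilde_adj n h) = h.

Definition normal_op (A : H -> H) : Prop :=
  forall h, A (adjoint f A h) = adjoint f A (A h).

Definition spherical : Prop :=
  (forall i, normal_op (T i)) /\ forall h, \sum_i T i (adjoint f (T i) h) = h.

Lemma wordop_linear n (w : {ffun 'I_n -> 'I_d}) : linear (wordop w).
Proof.
move=> a x y; rewrite /wordop; elim: [seq _ | _ <- _] => //= i s ->.
by rewrite linearP.
Qed.

Lemma wordop_perm n (w : {ffun 'I_n -> 'I_d}) (s : 'S_n) h :
  (forall i j h, T i (T j h) = T j (T i h)) ->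
  wordop [ffun i => w (s i)] h = wordop w h.
Proof.
move=> TC; rewrite /wordop.
have foldC u v : perm_eq u v ->
    foldr (fun i x => T i x) h u = foldr (fun i x => T i x) h v.
  elim: u v => [|i u IH] v; first by rewrite perm_sym => /perm_nilP ->.
  move=> uv; have /path.splitPr vi : i \in v by rewrite -(perm_mem uv) mem_head.
  case: vi uv => v1 v2; rewrite perm_sym perm_catC /= perm_cons perm_catC.
  rewrite perm_sym => /IH /= ->; elim: v1 {IH} => //= j v1 <-; exact: TC.
apply: foldC; rewrite (eq_map (g := w \o s)) => [|i]; last by rewrite ffunE.
rewrite map_comp; apply: perm_map; apply: uniq_perm; rewrite ?enum_uniq //.
  by rewrite map_inj_uniq ?enum_uniq //; exact: perm_inj.
move=> i; rewrite mem_enum; apply/mapP; exists (s^-1%g i); by rewrite ?mem_enum ?permKV.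
Qed.

Lemma rep_symproj_basis n (w : {ffun 'I_n -> 'I_d}) h :
  (forall i j h, T i (T j h) = T j (T i h)) ->
  rep (symproj (pure_tensor (fun i => delta_mx 0 (w i)))) h = wordop w h.
Proof.
move=> TC; rewrite /rep.
under eq_bigr do rewrite ffunE -scalerA scaler_suml.
rewrite -scaler_sumr exchange_big /=.
have E (s : 'S_n) : \sum_(v : {ffun 'I_n -> 'I_d})
    pure_tensor (fun i => delta_mx 0 (w i) : 'rV[C]_d) [ffun i => v (s i)] *:
      wordop v h = wordop w h.
  rewrite -(wordop_perm w s^-1 h TC) (bigD1 [ffun i => w (s^-1%g i)]) //=.
  rewrite big1 ?addr0.
    rewrite ffunE big1 ?scale1r // => i _.
    by rewrite !mxE !ffunE permK !eqxx.
  move=> v vw; rewrite ffunE; suff [i iw] : exists i, v (s i) != w i.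
    by rewrite (bigD1 i) //= !mxE !ffunE (negPf iw) andbF mul0r scale0r.
  apply/existsP; apply: contraNT vw; rewrite negb_exists => /forallP vw.
  apply/eqP/ffunP => i; rewrite ffunE.
  by have := vw (s^-1%g i); rewrite permKV negbK => /eqP.
under eq_bigr do rewrite E.
rewrite sumr_const card_Sn -[wordop _ _ *+ _]scaler_nat scalerA mulVf ?scale1r //.
Qed.

Lemma rep_tilde_tensor n (zeta : tpow d n C^o) h :
  rep_tilde [ffun w => zeta w *: h] = rep zeta h.
Proof.
apply: eq_bigr => w _; rewrite ffunE.
have := wordop_linear w (zeta w) h 0; rewrite addr0 => ->.
suff -> : wordop w 0 = 0 by rewrite addr0.
by have := wordop_linear w (-1) 0 0; rewrite scaler0 add0r scaleN1r addNr.
Qed.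

End RowContractions.

(* Main.v *)
Require Import Defs.
From HB Require Import structures.
From mathcomp Require Import all_boot all_order all_algebra all_fingroup.
From mathcomp Require Import sesquilinear complex.
From mathcomp Require Import lra zify.
From mathcomp Require Import all_classical all_reals all_analysis.
Set Implicit Arguments.
Unset Strict Implicit.
Unset Printing Implicit Defensive.
Import Order.TTheory GRing.Theory Num.Theory Num.Def.
Import numFieldNormedType.Exports.
Local Open Scope classical_set_scope.
Local Open Scope ring_scope.

(** Put A_i = T_i^*; coisometry says sum_i |A_i h|^2 = |h|^2, and the adjoint of
    the n-th row operator is h |-> (A_w h)_w. Expanding the projection,
    |p_l (eta (x) (A_w h)_w)|^2 is the average over the permutations s of l
    letters of the correlations of eta (x) (A_w h)_w with its permutation by s.
    If s moves the first m positions off themselves, commutation and the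
    isometry property evaluate the correlation to |T_m(eta)^* h|^2; the other
    s have proportion at most m^2 / l and bounded correlations. So for every
    commuting coisometric T the limit is |T_m(eta)^* h|. For m = 1 and
    eta = e_i the condition thus reads |T_i^* h| = |T_i h|, that is, T_i is
    normal. Conversely normality of the T_i makes T_m(eta) normal, because the
    T_i then commute with the T_j^*. *)

(** * Extending and counting permutations *)

(** By induction on [r]: composing with the transposition of [s x] and [g x] corrects the value at
    [x] and, by injectivity of [s] and [g], leaves the values on the tail alone. *)
Lemma perm_extend (X : finType) (r : seq X) (g : X -> X) :
  uniq r -> {in r &, injective g} ->
  exists s : {perm X}, {in r, s =1 g}.
Proof.
elim: r => [|x r IH] /=; first by exists 1%g.
move=> /andP[xr ur] gI; have [|s sg] := IH ur.
  by move=> y z yr zr; apply: gI; rewrite in_cons ?yr ?zr orbT.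
exists (s * tperm (s x) (g x))%g => y; rewrite in_cons permM.
have [-> _|yx /= yr] := eqVneq y x; first by rewrite tpermL.
rewrite -(sg y yr) tpermD //; first by rewrite (inj_eq perm_inj) eq_sym.
rewrite (sg y yr); apply: contraNneq yx => gxy; apply/eqP.
by apply: gI => //; rewrite in_cons ?yr ?eqxx ?orbT.
Qed.

(** Right multiplication by [tperm b c] matches the fibres of [s |-> s a] over [b] and [c], so all
    [n] fibres have the same size. *)
Lemma card_perm_pt n (a b : 'I_n) :
  (#|[pred s : 'S_n | s a == b]| * n = n`!)%N.
Proof.
rewrite -card_Sn -[RHS]sum1_card 
  (partition_big (fun s : 'S_n => s a) predT) //=.
rewrite (eq_bigr (fun=> #|[pred s : 'S_n | s a == b]|)); last first.
  move=> c _; rewrite -sum1_card (reindex_inj (mulIg (tperm b c))) /=.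
  apply: eq_bigl => s; rewrite inE permM.
  by rewrite (can2_eq (tpermK b c) (tpermK b c)) tpermR.
by rewrite sum_nat_const card_ord mulnC.
Qed.

Definition displaces m k (s : 'S_(m + k)) :=
  [forall i : 'I_m, m <= s (lshift k i)]%N.

(** Union bound: a permutation that is not displacing sends some [i] to some [j] inside the first
    block, and each of the [m ^ 2] pairs accounts for a proportion [1 / (m + k)] of all
    permutations. *)
Lemma card_not_displaces m k :
  (#|[pred s : 'S_(m + k) | ~~ displaces s]| * (m + k) <= m ^ 2 * (m + k)`!)%N.
Proof.
pose B (p : 'I_m * 'I_m) :=
  [pred s : 'S_(m + k) | s (lshift k p.1) == lshift k p.2].
have : (#|[pred s : 'S_(m + k) | ~~ displaces s]| <= \sum_p #|B p|)%N.
  rewrite -sum1_card; under [leqRHS]eq_bigr do rewrite -sum1_card big_mkcond.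
  rewrite exchange_big /= [leqLHS]big_mkcond /=; apply: leq_sum => s _.
  case: ifPn => //; rewrite inE negb_forall => H.
  have [i si] := fintype.existsP H; rewrite -ltnNge in si.
  by rewrite (bigD1 (i, Ordinal si)) //= ifT // inE; apply/eqP/val_inj.
move=> bnd; apply: (leq_trans (leq_mul bnd (leqnn _))); rewrite big_distrl /=.
under eq_bigr do rewrite card_perm_pt.
by rewrite sum_nat_const card_prod card_ord mulnn.
Qed.

(** * Splitting words into blocks of positions *)

Lemma sum_word_split (D : finType) (V : nmodType) m k
    (F : {ffun 'I_m -> D} -> {ffun 'I_k -> D} -> V) :
  \sum_(w : {ffun 'I_(m + k) -> D})
     F [ffun i => w (lshift k i)] [ffun j => w (rshift m j)] =
  \sum_u \sum_v F u v.
Proof.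
rewrite pair_big /=.
pose cat (p : {ffun 'I_m -> D} * {ffun 'I_k -> D}) : {ffun 'I_(m + k) -> D} :=
  [ffun i => match fintype.split i with inl a => p.1 a | inr b => p.2 b end].
rewrite (reindex cat) /=.
  apply: eq_bigr => -[u v] _; congr F; apply/ffunP => i; rewrite !ffunE.
    by rewrite (unsplitK (inl i)).
  by rewrite (unsplitK (inr i)).
exists (fun w => ([ffun i => w (lshift k i)], [ffun j => w (rshift m j)])).
  move=> [u v] _; congr (_, _); apply/ffunP => i; rewrite !ffunE.
    by rewrite (unsplitK (inl i)).
  by rewrite (unsplitK (inr i)).
move=> w _; apply/ffunP => i; rewrite !ffunE.
by case: split_ordP => j ->; rewrite ffunE.
Qed.

Lemma sum_word0 (D : finType) (V : nmodType) (F : {ffun 'I_0 -> D} -> V) w :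
  \sum_v F v = F w.
Proof.
rewrite (big_pred1 w) // => v; apply/esym/eqP/ffunP; by case.
Qed.

Lemma sum_word1 (D : finType) (V : nmodType) (F : {ffun 'I_1 -> D} -> V) :
  \sum_w F w = \sum_i F [ffun=> i].
Proof.
rewrite (reindex (fun i : D => [ffun=> i] : {ffun 'I_1 -> D})) //.
exists (fun w : {ffun 'I_1 -> D} => w ord0) => [i|w] _; first by rewrite ffunE.
by apply/ffunP => i; rewrite ffunE (ord1 i).
Qed.

Lemma enum_ord_split m k :
  enum 'I_(m + k) =
  [seq lshift k i | i <- enum 'I_m] ++ [seq rshift m j | j <- enum 'I_k].
Proof.
apply: (inj_map val_inj); rewrite val_enum_ord map_cat.
rewrite -(map_comp val (lshift k)) -(map_comp val (rshift m (n := k))).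
rewrite (eq_map (g := val) (fun=> erefl)) val_enum_ord.
rewrite [X in _ ++ X](eq_map (g := addn m \o val) (fun=> erefl)).
rewrite [X in _ ++ X]map_comp val_enum_ord.
by rewrite -iotaDl addn0 iotaD.
Qed.

Lemma perm_enum_split m k (s : 'S_(m + k)) :
  perm_eq ([seq s (lshift k i) | i <- enum 'I_m] ++
           [seq s (rshift m j) | j <- enum 'I_k])
          (enum 'I_(m + k)).
Proof.
rewrite (map_comp s) [X in _ ++ X](map_comp s) -map_cat -enum_ord_split.
apply: uniq_perm; rewrite ?(map_inj_uniq (@perm_inj _ s)) ?enum_uniq //.
move=> i; rewrite mem_enum; apply/mapP.
by exists (s^-1%g i); rewrite ?mem_enum ?permKV.
Qed.

Lemma foldr_perm_eq (I : eqType) (V : Type) (g : I -> V -> V) (u v : seq I) h :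
  (forall i j x, g i (g j x) = g j (g i x)) ->
  perm_eq u v -> foldr g h u = foldr g h v.
Proof.
move=> gC; elim: u v => [|i u IH] v; first by rewrite perm_sym => /perm_nilP ->.
move=> uv; have /path.splitPr vi : i \in v by rewrite -(perm_mem uv) mem_head.
case: vi uv => v1 v2; rewrite perm_sym perm_catC /= perm_cons perm_catC.
by rewrite perm_sym => /IH /= ->; elim: v1 {IH} => //= j v1 <-; exact: gC.
Qed.

(* Relabelling positions by t reduces the computation of the correlation at a
   displacing s to the swap of the first two blocks of length m. *)
Lemma perm_align m k (s : 'S_(m + (m + k))) : displaces s ->
  exists t : 'S_(m + (m + k)),
    (forall i, t (lshift (m + k) i) = lshift (m + k) i) /\
    (forall i, t (rshift m (lshift k i)) = s (lshift (m + k) i)).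
Proof.
move=> /fintype.forallP sd.
(* [g] fixes the first block and sends place [i] of the second block to [s i]. As [s] is displacing,
   [g] is injective on these two blocks, and any permutation extending it from there serves as
   [t]. *)
pose g (x : 'I_(m + (m + k))) := match fintype.split x with
  | inl _ => x
  | inr j => if fintype.split j is inl i then s (lshift (m + k) i) else x end.
have gl i : g (lshift (m + k) i) = lshift (m + k) i.
  by rewrite /g (unsplitK (inl i)).
have gr i : g (rshift m (lshift k i)) = s (lshift (m + k) i).
  by rewrite /g (unsplitK (inr (lshift k i))) (unsplitK (inl i)).
have sl i j : s (lshift (m + k) i) <> lshift (m + k) j.
  by move=> e; have := sd i; rewrite e /= leqNgt ltn_ord.
pose r := [seq lshift (m + k) i | i <- enum 'I_m] ++
  [seq rshift m (lshift k i) | i <- enum 'I_m].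
have rU : uniq r.
  have := enum_uniq 'I_(m + (m + k)).
  rewrite enum_ord_split [enum 'I_(m + k)]enum_ord_split map_cat catA.
  by rewrite -map_comp cat_uniq => /andP[].
have [|t tg] := perm_extend rU (g := g).
  move=> x y; rewrite !mem_cat => /orP[]/mapP[i _ ->] /orP[]/mapP[j _ ->];
    rewrite ?gl ?gr //.
  - by move/esym/sl.
  - by move/sl.
  - by move/perm_inj/lshift_inj ->.
exists t; split=> i; rewrite tg ?gl ?gr // mem_cat.
  by rewrite map_f ?mem_enum.
by apply/orP; right; apply/mapP; exists i; rewrite ?mem_enum.
Qed.

Lemma map_ffun (X : finType) (Y : Type) (g : X -> Y) s :
  [seq [ffun x => g x] i | i <- s] = [seq g i | i <- s].
Proof. by apply: eq_map => i; rewrite ffunE. Qed.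

(** * Products of commuting operators along words *)

Section Words.
Variables (R : realType) (d : nat) (H : completeNormedModType R[i]).
Local Notation C := R[i].
Variable A : 'I_d -> {linear H -> H}.

HB.instance Definition _ n (w : {ffun 'I_n -> 'I_d}) :=
  GRing.isLinear.Build _ _ _ _ (wordop A w) (wordop_linear A w).

Lemma wordop0 (w : {ffun 'I_0 -> 'I_d}) h : wordop A w h = h.
Proof. by rewrite /wordop enum_ord0. Qed.

Lemma wordop1 i h : wordop A ([ffun=> i] : {ffun 'I_1 -> 'I_d}) h = A i h.
Proof. by rewrite /wordop enum_ordSl enum_ord0 /= ffunE. Qed.

Lemma wordop_split m k (w : {ffun 'I_(m + k) -> 'I_d}) h :
  wordop A w h = wordop A [ffun i => w (lshift k i)]
                   (wordop A [ffun j => w (rshift m j)] h).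
Proof.
rewrite /wordop -foldr_cat enum_ord_split map_cat -!(map_comp w).
by rewrite !map_ffun.
Qed.

Hypothesis AC : forall i j h, A i (A j h) = A j (A i h).

Lemma wordop_letterC n (w : {ffun 'I_n -> 'I_d}) i h :
  wordop A w (A i h) = A i (wordop A w h).
Proof.
by rewrite /wordop; elim: [seq _ | _ <- _] => //= j s ->; rewrite AC.
Qed.

Lemma wordopC m k (v : {ffun 'I_m -> 'I_d}) (w : {ffun 'I_k -> 'I_d}) h :
  wordop A v (wordop A w h) = wordop A w (wordop A v h).
Proof.
rewrite {1 4}/wordop; elim: [seq v _ | _ <- _] => //= j s ->.
by rewrite wordop_letterC.
Qed.

(** If [s] fixes the first block pointwise, it only reorders the remaining letters, which commuting
    operators do not see. *)
Lemma wordop_rest_fix m k (w : {ffun 'I_(m + k) -> 'I_d}) (s : 'S_(m + k)) h :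
  (forall i, s (lshift k i) = lshift k i) ->
  wordop A [ffun j : 'I_k => w (s (rshift m j))] h =
  wordop A [ffun j : 'I_k => w (rshift m j)] h.
Proof.
move=> sE; apply: foldr_perm_eq => //.
rewrite !map_ffun.
rewrite (map_comp w) [X in perm_eq _ X](map_comp w); apply: perm_map.
have := perm_enum_split s; rewrite (eq_map sE) enum_ord_split perm_cat2l.
by [].
Qed.

(** The second block being the image of the first, the other positions are mapped onto the first and
    third blocks, in an order that does not matter. *)
Lemma wordop_rest_swap m k (w : {ffun 'I_(m + (m + k)) -> 'I_d})
    (s : 'S_(m + (m + k))) h :
  (forall i, s (lshift (m + k) i) = rshift m (lshift k i)) ->
  wordop A [ffun j => w (s (rshift m j))] h =
  wordop A [ffun i => w (lshift (m + k) i)]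
    (wordop A [ffun j => w (rshift m (rshift m j))] h).
Proof.
move=> sE; rewrite /wordop -foldr_cat; apply: foldr_perm_eq => //.
rewrite !map_ffun.
rewrite (map_comp w) [X in perm_eq _ (X ++ _)](map_comp w).
rewrite [X in perm_eq _ (_ ++ X)](map_comp w) -map_cat; apply: perm_map.
have := perm_enum_split s; rewrite (eq_map sE) => sP.
rewrite -(perm_cat2l [seq rshift m (lshift k i) | i <- enum 'I_m]).
apply: perm_trans sP _; rewrite perm_sym perm_catCA enum_ord_split perm_cat2l.
by rewrite (map_comp (rshift m (n := _)) (lshift k))
  (map_comp (rshift m (n := _)) (rshift m (n := _)))
  -map_cat -enum_ord_split.
Qed.

Variable f : {dot H for conjC}.
Hypothesis Aiso : forall x y, \sum_i f (A i x) (A i y) = f x y.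

(** Induction on the length: the sum over the first, outermost letter is removed by [Aiso]. *)
Lemma wordop_iso n x y :
  \sum_(w : {ffun 'I_n -> 'I_d}) f (wordop A w x) (wordop A w y) = f x y.
Proof.
elim: n => [|n IH] in x y *.
  (* The witness is the empty word, written so that it exists for [d = 0] as well. *)
  by rewrite (sum_word0 _ [ffun i => widen_ord (leq0n d) i]) !wordop0.
under eq_bigr => w _ do rewrite !(@wordop_split 1 n w).
rewrite (sum_word_split (m := 1) (fun u v => f (wordop A u (wordop A v x))
    (wordop A u (wordop A v y)))).
rewrite exchange_big /=; under eq_bigr do rewrite sum_word1.
under eq_bigr do under eq_bigr do rewrite !wordop1.
by under eq_bigr do rewrite Aiso.
Qed.

End Words.

(** * Real parts and inner products *)

Section ComplexRe.
Variable R : realType.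
Local Notation C := R[i].
Local Notation Re := (@complex.Re R).

Lemma ReD (x y : C) : Re (x + y) = Re x + Re y.
Proof. by case: x; case: y. Qed.

Lemma ReN (x : C) : Re (- x) = - Re x.
Proof. by case: x. Qed.

Lemma Re_sum (I : Type) (r : seq I) (P : pred I) (F : I -> C) :
  Re (\sum_(i <- r | P i) F i) = \sum_(i <- r | P i) Re (F i).
Proof. by apply: (big_morph Re ReD). Qed.

Lemma Re_conj (x : C) : Re (x^*)%R = Re x.
Proof. by case: x. Qed.

Lemma Re_natVM n (x : C) : Re ((n%:R)^-1 * x) = (n%:R)^-1 * Re x.
Proof.
have -> : (n%:R^-1 : C) = (n%:R^-1)%:C%C by rewrite fmorphV rmorph_nat.
by case: x => a b /=; rewrite mul0r subr0.
Qed.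

Lemma Re_ge0 (x : C) : 0 <= x -> 0 <= Re x.
Proof. by rewrite lecE => /andP[]. Qed.

Lemma ge0_ReE (x : C) : 0 <= x -> x = (Re x)%:C%C.
Proof. by move=> x0; rewrite RRe_real // ger0_real. Qed.

End ComplexRe.

Section Dot.
Variables (R : realType) (V : lmodType R[i]) (f : {dot V for conjC}).
Local Notation Re := (@complex.Re R).

Lemma Re_dot_ge0 x : 0 <= Re (f x x).
Proof. exact/Re_ge0/dnorm_ge0. Qed.

Lemma dotC x y : f x y = (f y x)^*.
Proof. by rewrite hermC expr0 mul1r. Qed.

(** Positivity of the form at [x + y] and [x - y]. This replaces Cauchy-Schwarz in [corr_le], where
    both vectors have the same norm. *)
Lemma Re_dot_le x y : `|Re (f x y)| *+ 2 <= Re (f x x) + Re (f y y).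
Proof.
have := Re_dot_ge0 (x + y); have := Re_dot_ge0 (x - y).
have E : Re (f y x) = Re (f x y) by rewrite dotC Re_conj.
rewrite linearBl !linearBr linearDl !linearDr !(ReD, ReN) E.
rewrite -normrMn ler_norml; lra.
Qed.

Lemma dot_sep x y : (forall z, f z x = f z y) -> x = y.
Proof.
move=> xy; apply/eqP; rewrite -subr_eq0 -(dnorm_eq0 f).
by rewrite linearBr subr_eq0; apply/eqP/xy.
Qed.

Lemma dnorm_sqr x : dnorm f x ^+ 2 = Re (f x x).
Proof. by rewrite /dnorm sqr_sqrtr ?Re_dot_ge0. Qed.

End Dot.

(** * The norm of a symmetrized tensor as an average of correlations *)

Section Symmetrization.
Variables (R : realType) (d : nat) (V : lmodType R[i]) (f : {dot V for conjC}).
Local Notation C := R[i].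
Local Notation Re := (@complex.Re R).

Definition corr n (F : tpow d n V) (s : 'S_n) : C :=
  \sum_(w : {ffun 'I_n -> 'I_d}) f (F w) (F [ffun i => w (s i)]).

Lemma reindex_word n (s : 'S_n) (W : nmodType) (g : {ffun 'I_n -> 'I_d} -> W) :
  \sum_w g w = \sum_(w : {ffun 'I_n -> 'I_d}) g [ffun i => w (s i)].
Proof.
rewrite (reindex (fun w : {ffun 'I_n -> 'I_d} => [ffun i => w (s i)])) //.
exists (fun w : {ffun 'I_n -> 'I_d} => [ffun i => w (s^-1%g i)]) => w _;
  by apply/ffunP => i; rewrite !ffunE ?permK ?permKV.
Qed.

(** The left side is a double average over [s] and [t] of the products of two permuted copies of
    [F]. Replacing [t] by [t * s] and relabelling words by [s^-1] leaves [corr F t], so the sum over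
    [s] cancels one factor [n!]. *)
Lemma symproj_dot n (F : tpow d n V) :
  tdot f (symproj F) (symproj F) = (n`!%:R)^-1 * \sum_(s : 'S_n) corr F s.
Proof.
pose S (w : {ffun 'I_n -> 'I_d}) := \sum_(s : 'S_n) F [ffun i => w (s i)].
have SS : \sum_w f (S w) (S w) = n`!%:R * \sum_(s : 'S_n) corr F s.
  have -> : \sum_w f (S w) (S w) = \sum_(s : 'S_n) \sum_(t : 'S_n)
      \sum_(w : {ffun 'I_n -> 'I_d})
      f (F [ffun i => w (s i)]) (F [ffun i => w (t i)]).
    under eq_bigr => w _.
      rewrite /S linear_sumlz.
      under eq_bigr do rewrite linear_sumr.
      over.
    rewrite exchange_big /=; apply: eq_bigr => s _.
    by rewrite exchange_big.
  rewrite -card_Sn mulr_natl -sumr_const.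
  apply: eq_bigr => s _; rewrite (reindex_inj (mulIg s)).
  apply: eq_bigr => t _; rewrite (reindex_word s^-1); apply: eq_bigr => w _.
  congr (f (F _) (F _)); apply/ffunP => i; rewrite !ffunE ?permK //.
  by rewrite permM permK.
have n0 : (n`!%:R : C) != 0 by rewrite pnatr_eq0 -lt0n fact_gt0.
rewrite /tdot; under eq_bigr => w _.
  rewrite ffunE -/(S w) linearZl_LR linearZr_LR /=.
  over.
rewrite -!mulr_sumr SS fmorphV rmorph_nat; congr (_ * _).
by rewrite mulKf.
Qed.

Lemma corr_le n (F : tpow d n V) s : `|Re (corr F s)| <= Re (tdot f F F).
Proof.
rewrite -(ler_pMn2r (n := 2)) //.
pose Fs := [ffun w : {ffun 'I_n -> 'I_d} => F [ffun i => w (s i)]].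
have -> : corr F s = tdot f F Fs by apply: eq_bigr => w _; rewrite ffunE.
have le : `|Re (tdot f F Fs)| *+ 2 <= Re (tdot f F F) + Re (tdot f Fs Fs).
  exact: (Re_dot_le (tdot (d := d) (n := n) f)).
suff E : tdot f Fs Fs = tdot f F F by rewrite E in le; rewrite mulr2n.
by rewrite /tdot [RHS](reindex_word s); apply: eq_bigr => w _; rewrite ffunE.
Qed.

End Symmetrization.

(** * The limit for commuting operators whose column is isometric *)

Section Limit.
Variables (R : realType) (d : nat) (H : completeNormedModType R[i]).
Variables (f : {dot H for conjC}) (A : 'I_d -> {linear H -> H}).
Local Notation C := R[i].
Local Notation Re := (@complex.Re R).
Hypothesis AC : forall i j h, A i (A j h) = A j (A i h).
Hypothesis Aiso : forall x y, \sum_i f (A i x) (A i y) = f x y.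

Definition wordvec n h : tpow d n H :=
  [ffun w : {ffun 'I_n -> 'I_d} => wordop A w h].

(** For [A i] the adjoint of [T i] this is the adjoint of T_n(eta) applied to [h], hence the
    conjugate coefficients. *)
Definition dual_rep n (eta : tpow d n C^o) h : H :=
  \sum_w (eta w)^* *: wordop A w h.

(** After relabelling, a word splits as [u x r], and the summand is [eta u] times the conjugate of
    [eta x] times <A_x A_r h, A_u A_r h>. Moving A_r outermost and summing over [r] by isometry
    leaves <A_x h, A_u h>. *)
Lemma corr_displaces m k (eta : tpow d m C^o) h (s : 'S_(m + (m + k))) :
  displaces s ->
  corr f (tensor eta (wordvec (m + k) h)) s =
  f (dual_rep eta h) (dual_rep eta h).
Proof.
move=> sd; have [t [tl tr]] := perm_align sd.
have tVl i : t^-1%g (lshift (m + k) i) = lshift (m + k) i.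
  by rewrite -[in LHS](tl i) permK.
have ql i : (s * t^-1)%g (lshift (m + k) i) = rshift m (lshift k i).
  by rewrite permM -tr permK.
pose Phi (u : {ffun 'I_m -> 'I_d}) (v : {ffun 'I_(m + k) -> 'I_d}) :=
  f (eta u *: wordop A v h)
    (eta [ffun i => v (lshift k i)] *:
       wordop A u (wordop A [ffun j => v (rshift m j)] h)).
(* In the new labels the left copy of [eta] still reads the first block, while the right copy reads
   the second one by [ql]. *)
rewrite /corr (reindex_word t^-1%g).
rewrite (eq_bigr (fun w : {ffun 'I_(m + (m + k)) -> 'I_d} =>
  Phi [ffun i => w (lshift (m + k) i)] [ffun j => w (rshift m j)])); last first.
  move=> w _; rewrite /Phi !ffunE; congr (f (_ *: _) (_ *: _)).
  - by congr (eta _); apply/ffunP => i; rewrite !ffunE tVl.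
  - rewrite -(wordop_rest_fix AC w h tVl); congr (wordop A _ h).
    by apply/ffunP => i; rewrite !ffunE.
  - by congr (eta _); apply/ffunP => i; rewrite !ffunE -permM ql.
  - rewrite (_ : [ffun j => _] = [ffun j => w ((s * t^-1)%g (rshift m j))]).
      rewrite (wordop_rest_swap AC w h ql); congr (wordop A _ (wordop A _ h)).
      by apply/ffunP => i; rewrite !ffunE.
    by apply/ffunP => i; rewrite !ffunE permM.
rewrite (sum_word_split Phi) /Phi.
under eq_bigr => u _.
  under eq_bigr => v _ do rewrite (wordop_split _ v).
  rewrite (sum_word_split (fun x r => f (eta u *: wordop A x (wordop A r h))
    (eta x *: wordop A u (wordop A r h)))).
  under eq_bigr => x _.
    under eq_bigr => r _.
      rewrite linearZl_LR linearZr_LR /= (wordopC AC x) (wordopC AC u).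
      over.
    rewrite -!mulr_sumr wordop_iso //.
    over.
  over.
rewrite exchange_big /= /dual_rep linear_sumlz; apply: eq_bigr => x _.
rewrite linear_sumr; apply: eq_bigr => u _.
by rewrite linearZl_LR /= [X in _ = _ * X]linearZr_LR /= conjCK mulrCA.
Qed.

(** The value does not depend on [k], which makes the error bound below uniform in the length. *)
Lemma tensor_wordvec_dot m k (eta : tpow d m C^o) h :
  tdot f (tensor eta (wordvec k h)) (tensor eta (wordvec k h)) =
  (\sum_u `|eta u : C| ^+ 2) * f h h.
Proof.
rewrite /tdot (eq_bigr (fun w : {ffun 'I_(m + k) -> 'I_d} =>
  (fun u v => `|eta u : C| ^+ 2 * f (wordop A v h) (wordop A v h))
    [ffun i => w (lshift k i)] [ffun j => w (rshift m j)])); last first.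
  by move=> w _; rewrite !ffunE dnormZ.
rewrite (sum_word_split (fun u v => `|eta u : C| ^+ 2 *
   f (wordop A v h) (wordop A v h))).
rewrite mulr_suml; apply: eq_bigr => u _.
by rewrite -mulr_sumr wordop_iso.
Qed.

(** Written as averages over all permutations, the two terms agree at displacing ones and differ by
    at most [N] at the others, which are counted by [card_not_displaces]. *)
Lemma symproj_tensor_near m k (eta : tpow d m C^o) h :
  (0 < m)%N ->
  let G := tensor eta (wordvec (m + k) h) in
  let z := dual_rep eta h in
  `|Re (tdot f (symproj G) (symproj G)) - Re (f z z)| <=
  (m ^ 2)%:R / (m + (m + k))%:R *
  (Re (tdot f G G) + Re (f z z)).
Proof.
move=> m0; cbv zeta; set G := tensor _ _; set z := dual_rep _ _.
set L := (m + (m + k))%N; set N := (X in _ <= _ * X).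
have L0 : (0 < L)%N by rewrite addn_gt0 m0.
have N0 : 0 <= N.
  by rewrite addr_ge0 //; [|exact: (Re_dot_ge0 f)];
    exact: (Re_dot_ge0 (tdot (d := d) (n := L) f)).
have fL0 : 0 < (L`!%:R : R) by rewrite ltr0n fact_gt0.
rewrite symproj_dot Re_natVM Re_sum.
have -> : Re (f z z) = (L`!%:R)^-1 * \sum_(s : 'S_L) Re (f z z).
  by rewrite sumr_const card_Sn -[complex.Re _ *+ _]mulr_natl mulKf ?gt_eqF.
rewrite -mulrBr -sumrB normrM ger0_norm ?invr_ge0 ?ler0n // ler_pdivrMl //.
apply: le_trans (ler_norm_sum _ _ _) _.
apply: (@le_trans _ _ (\sum_(s : 'S_L | ~~ displaces s) N)).
  rewrite [leRHS]big_mkcond /=; apply: ler_sum => s _.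
  case: ifPn => [sd|]; last first.
    by rewrite negbK => sd; rewrite corr_displaces ?subrr ?normr0.
  apply: le_trans (ler_normB _ _) _; rewrite lerD //.
    exact: corr_le.
  by rewrite ger0_norm //; exact: (Re_dot_ge0 f).
rewrite sumr_const -[N *+ _]mulr_natl [leRHS]mulrA ler_wpM2r //.
rewrite mulrA ler_pdivlMr ?ltr0n //.
rewrite -!natrM ler_nat [leqRHS]mulnC; exact: card_not_displaces.
Qed.

Lemma cvg_symproj_tensor m (eta : tpow d m C^o) h : (0 < m)%N ->
  (fun l : nat => dnorm (tdot f (n := m + (l - m)))
       (symproj (tensor eta (wordvec (l - m) h)))) @ \oo
      --> dnorm f (dual_rep eta h).
Proof.
move=> m0; set z := dual_rep eta h.
pose X l := Re (tdot f (symproj (tensor eta (wordvec (l - m) h)))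
                       (symproj (tensor eta (wordvec (l - m) h)))).
suff : X l @[l --> \oo] --> Re (f z z).
  move=> Xz.
  exact: (@continuous_cvg _ _ _ \oo _ X Num.sqrt _ (@sqrt_continuous R _) Xz).
set N := Re ((\sum_u `|eta u : C| ^+ 2) * f h h) + Re (f z z).
apply/cvgrPdist_le => e e0; near=> l; rewrite distrC /X.
(* From here on the truncated subtractions are exact, and there is room for a second block of length
   [m]. *)
have lm : (m + m <= l)%N by near: l; exact: nbhs_infty_ge.
have -> : (l - m = m + (l - m - m))%N by lia.
apply: le_trans (symproj_tensor_near _ _ _ m0) _.
have -> : tdot f (tensor eta (wordvec (m + (l - m - m)) h))
                 (tensor eta (wordvec (m + (l - m - m)) h)) =
          (\sum_u `|eta u : C| ^+ 2) * f h h by exact: tensor_wordvec_dot.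
have -> : (m + (m + (l - m - m)) = l)%N by lia.
rewrite -/z -/N mulrAC ler_pdivrMr ?ltr0n; last by lia.
rewrite [leRHS]mulrC -ler_pdivrMr //; near: l; exact: nbhs_infty_ger.
Unshelve. all: by end_near.
Qed.

End Limit.

(** * Existence and uniqueness of adjoints *)

Section Adjoints.
Variable R : realType.
Local Notation C := R[i].

(** The difference of two candidates lies in [D] and is orthogonal to itself. *)
Lemma adjoint_on_eq (V W : lmodType C) (fV : {dot V for conjC})
    (fW : {dot W for conjC}) (D : set V) (A : V -> W) y x :
  (forall u v, D u -> D v -> D (u - v)) -> D x ->
  (forall v, D v -> fW (A v) y = fV v x) -> adjoint_on fV fW D A y = x.
Proof.
move=> DB Dx xE; apply: xget_unique => // x' [Dx' x'E].
apply/eqP; rewrite -subr_eq0 -(dnorm_eq0 fV) linearBr subr_eq0; apply/eqP.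
have xB : D (x' - x) by exact: DB.
exact: etrans (esym (x'E _ xB)) (xE _ xB).
Qed.

Lemma symproj_fixed d n (V : lmodType C) (F : tpow d n V) :
  (forall (s : 'S_n) (w : {ffun 'I_n -> 'I_d}), F [ffun i => w (s i)] = F w) ->
  symproj F = F.
Proof.
move=> Fs; apply/ffunP => w; rewrite ffunE.
under eq_bigr do rewrite Fs.
by rewrite sumr_const card_Sn -[F w *+ _]scaler_nat scalerA mulVf ?scale1r //
  pnatr_eq0 -lt0n fact_gt0.
Qed.

Lemma sympow_fixed d n (V : lmodType C) (F : tpow d n V) :
  (forall (s : 'S_n) (w : {ffun 'I_n -> 'I_d}), F [ffun i => w (s i)] = F w) ->
  sympow F.
Proof. by move=> /symproj_fixed FE; exists F. Qed.

Lemma sympow1 d (V : lmodType C) (F : tpow d 1 V) : sympow F.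
Proof.
apply: sympow_fixed => s w; congr (F _); apply/ffunP => i.
by rewrite ffunE !ord1.
Qed.

Lemma sympowB d n (V : lmodType C) (F G : tpow d n V) :
  sympow F -> sympow G -> sympow (F - G).
Proof.
move=> [F' _ <-] [G' _ <-]; exists (F' - G') => //; apply/ffunP => w.
rewrite !ffunE -scalerBr -sumrB; congr (_ *: _).
by apply: eq_bigr => s _; rewrite !ffunE.
Qed.

Lemma dot_sqr_eq (V : lmodType C) (f : {dot V for conjC}) x y :
  dnorm f x = dnorm f y -> f x x = f y y.
Proof.
move=> xy; rewrite [LHS]ge0_ReE ?dnorm_ge0 // [RHS]ge0_ReE ?dnorm_ge0 //.
by rewrite -!dnorm_sqr xy.
Qed.

(* Polarization; this needs complex scalars. *)
Lemma dot_numrange0 (V : lmodType C) (f : {dot V for conjC})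
    (S : {linear V -> V}) :
  (forall x, f (S x) x = 0) -> forall x, S x = 0.
Proof.
move=> S0 x; apply/eqP; rewrite -(dnorm_eq0 f); apply/eqP.
have E y : f (S x) y + f (S y) x = 0.
  have := S0 (x + y); rewrite linearD linearDl !linearDr /= !S0 add0r addr0.
  by [].
have SZ : S ('i *: S x) = 'i *: S (S x) by rewrite linearZ.
(* Only the second argument is conjugated, so the two instances have opposite relative signs; their
   difference is twice the squared norm of [S x]. *)
have := E (S x); have := E ('i *: S x).
rewrite SZ [X in X + _]linearZr_LR [X in _ + X]linearZl_LR /=.
rewrite conjCi mulNr -mulrN -mulrDr.
move/eqP; rewrite mulf_eq0 (negPf (neq0Ci _)) /= => /eqP E1 E2.
have : f (S x) (S x) *+ 2 = 0.
  have := congr2 (fun a b => a - b) E2 E1.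
  by rewrite /= opprD opprK addrACA subrr addr0 subrr mulr2n.
by move/eqP; rewrite mulrn_eq0 => /eqP.
Qed.

Variables (d : nat) (H : completeNormedModType C) (f : {dot H for conjC}).
Variable T : 'I_d -> {linear H -> H}.

(* If h had no image under the adjoint of the row operator, rep_tilde_adj would
   take the junk value 0 at h, and coisometry would force h = 0; so no Riesz
   representation is needed. *)
Lemma coisometric_adjoint_ex : fully_coisometric f T ->
  forall i h, exists g, forall v, f (T i v) h = f v g.
Proof.
move=> Tco i h; have := Tco 1%N h; rewrite /rep_tilde_adj /adjoint_on.
set P := [set _ | _].
have [[F PF] _|/forallNP PN] := pselect (exists F, P F); last first.
  rewrite (xgetPN _ PN) => <-; exists 0 => v.
  rewrite /rep_tilde big1 ?linear0r // => w _.
  by rewrite ffunE linear0.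
case: PF => _ PF; exists (F [ffun=> i]) => v.
(* Testing against e_i (x) v isolates the coordinate of [F] at [i]. *)
pose G : tpow d 1 H :=
  [ffun w : {ffun 'I_1 -> 'I_d} => if w ord0 == i then v else 0].
have := PF G (sympow1 G); rewrite /rep_tilde /= /tdot !sum_word1.
rewrite (bigD1 i) //= [X in _ = X -> _](bigD1 i) //= !wordop1 !ffunE eqxx.
rewrite !big1 ?addr0 // => j ji; rewrite !ffunE (negPf ji) ?linear0l //.
by rewrite wordop1 linear0.
Qed.

Lemma coisometric_adjoint : fully_coisometric f T ->
  exists A : 'I_d -> {linear H -> H},
    (forall i, adjoint f (T i) =1 A i) /\
    (forall i v h, f (T i v) h = f v (A i h)).
Proof.
move=> Tco; have ex := coisometric_adjoint_ex Tco.
have TA i v h : f (T i v) h = f v (adjoint f (T i) h).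
  have [g gE] := ex i h.
  by rewrite /adjoint (@adjoint_on_eq _ _ f f setT (T i) h g).
have lin i : linear (adjoint f (T i)).
  move=> a x y; apply: (dot_sep (f := f)) => z.
  by rewrite -TA !linearPr /= !TA.
pose A i : {linear H -> H} := HB.pack_for {linear H -> H} (adjoint f (T i))
  (GRing.isLinear.Build _ _ _ _ (adjoint f (T i)) (lin i)).
exists A.
by split=> // i v h; rewrite TA.
Qed.

End Adjoints.

(** * Adjoints of the representation and normality *)

Section Coisometry.
Variables (R : realType) (d : nat) (H : completeNormedModType R[i]).
Variable f : {dot H for conjC}.
Variables T A : 'I_d -> {linear H -> H}.
Local Notation C := R[i].
Hypothesis TC : forall i j h, T i (T j h) = T j (T i h).
Hypothesis TA : forall i v h, f (T i v) h = f v (A i h).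

Lemma adjoint_opr i v h : f (A i v) h = f v (T i h).
Proof. by rewrite dotC -TA -dotC. Qed.

Lemma adjoint_commute i j h : A i (A j h) = A j (A i h).
Proof. by apply: (dot_sep (f := f)) => z; rewrite -!TA TC. Qed.

(** Taking adjoints reverses the word; commutation of the [A i] restores its order. *)
Lemma wordop_adjoint n (w : {ffun 'I_n -> 'I_d}) v h :
  f (wordop T w v) h = f v (wordop A w h).
Proof.
rewrite /wordop; elim: [seq _ | _ <- _] => //= i s IH in h *.
rewrite TA IH; congr (f v _); elim: s {IH} => //= j s ->.
exact: adjoint_commute.
Qed.

(** Since the [A i] commute, the family of all A_w h is already symmetric, so it lies in the domain
    in which the adjoint is sought. *)
Lemma rep_tilde_adjE n h : rep_tilde_adj f T n h = wordvec A n h.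
Proof.
apply: adjoint_on_eq => [F G||G _].
- exact: sympowB.
- apply: sympow_fixed => s w; rewrite !ffunE wordop_perm //.
  exact: adjoint_commute.
- rewrite /rep_tilde /= /tdot linear_sumlz; apply: eq_bigr => w _.
  by rewrite ffunE; exact: wordop_adjoint.
Qed.

Hypothesis Tco : fully_coisometric f T.

Lemma coisometric_sum h : \sum_i T i (A i h) = h.
Proof.
rewrite -[RHS](Tco 1%N) rep_tilde_adjE /rep_tilde sum_word1.
by apply: eq_bigr => i _; rewrite ffunE !wordop1.
Qed.

Lemma adjoint_isometric x y : \sum_i f (A i x) (A i y) = f x y.
Proof.
rewrite -{2}(coisometric_sum x) linear_sumlz.
by apply: eq_bigr => i _; exact/esym/TA.
Qed.

(* For the unital map Phi(X) = sum_i T_i X T_i^*, the normal operator T_j and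
   T_j^* T_j are both fixed by Phi, so T_j lies in the multiplicative domain of
   Phi and commutes with every T_i^*. This replaces Fuglede's theorem. *)
Lemma normal_doubly_commute : (forall i h, T i (A i h) = A i (T i h)) ->
  forall i j h, T j (A i h) = A i (T j h).
Proof.
move=> TN i j h; apply/eqP; rewrite -subr_eq0.
(* All four sums of products of [a] and [b] equal [f (T j h) (T j h)], so the squared norms of
   [a i - b i] add up to 0. *)
pose a i := T j (A i h); pose b i := A i (T j h).
have aa : \sum_i f (a i) (a i) = f (T j h) (T j h).
  rewrite -adjoint_opr -TN TA -adjoint_isometric; apply: eq_bigr => k _.
  by rewrite /a -adjoint_opr -TN TA !(adjoint_commute k).
have bb : \sum_i f (b i) (b i) = f (T j h) (T j h) by rewrite adjoint_isometric.
have ab : \sum_i f (a i) (b i) = f (T j h) (T j h).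
  rewrite -[X in _ = f (T j X) _]coisometric_sum linear_sum linear_sumlz.
  by apply: eq_bigr => k _; rewrite /a /b -TA TC.
have ba : \sum_i f (b i) (a i) = f (T j h) (T j h).
  rewrite [RHS]dotC -ab rmorph_sum; apply: eq_bigr => k _; exact: dotC.
have : \sum_i f (a i - b i) (a i - b i) = 0.
  under eq_bigr do rewrite linearBl !linearBr /=.
  by rewrite !sumrB aa ab ba bb !subrr.
move/eqP; rewrite psumr_eq0 => [/allP/(_ i)|k _]; last exact: dnorm_ge0.
by rewrite mem_index_enum dnorm_eq0 => /(_ isT).
Qed.

(** Double commutation gives <T_u h, T_x h> = <A_x T_u h, h> = <T_u A_x h, h> = <A_x h, A_u h>, and
    both squared norms expand in these with the same coefficients. *)
Lemma dnorm_rep_normal m (eta : tpow d m C^o) h :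
  (forall i h, T i (A i h) = A i (T i h)) ->
  dnorm f (rep T eta h) = dnorm f (dual_rep A eta h).
Proof.
move=> /normal_doubly_commute TAC; rewrite /dnorm.
congr (Num.sqrt (complex.Re _)).
have wC n (u : {ffun 'I_n -> 'I_d}) i v :
    wordop T u (A i v) = A i (wordop T u v).
  by rewrite /wordop; elim: [seq _ | _ <- _] => //= j s ->; exact: TAC.
have wwC n (u x : {ffun 'I_n -> 'I_d}) v :
    wordop T u (wordop A x v) = wordop A x (wordop T u v).
  by rewrite {2 3}/wordop; elim: [seq _ | _ <- _] => //= j s <-; exact: wC.
rewrite /rep /dual_rep !linear_sumlz.
under eq_bigr do rewrite linear_sumr.
under [RHS]eq_bigr do rewrite linear_sumr.
rewrite exchange_big /=; apply: eq_bigr => x _; apply: eq_bigr => u _.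
rewrite !linearZl_LR /= [X in _ * X = _]linearZr_LR.
rewrite [X in _ = _ * X]linearZr_LR /=.
rewrite conjCK mulrCA; congr (_ * (_ * _)).
rewrite [LHS]dotC wordop_adjoint -wwC -dotC.
exact: wordop_adjoint.
Qed.

Lemma spherical_normalP : (forall i, adjoint f (T i) =1 A i) ->
  spherical f T <-> forall i h, T i (A i h) = A i (T i h).
Proof.
move=> AE; rewrite /spherical /normal_op; split=> [[TN _] i h|TN].
  by rewrite -!AE; exact: TN.
split=> [i h|h]; first by rewrite !AE; exact: TN.
by under eq_bigr do rewrite AE; exact: coisometric_sum.
Qed.

(** The quadratic form of the commutator [S] is the difference of the two squared norms, hence zero,
    and [dot_numrange0] applies. *)
Lemma normal_of_dnorm i : (forall h, dnorm f (T i h) = dnorm f (A i h)) ->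
  forall h, T i (A i h) = A i (T i h).
Proof.
move=> TN h; apply/eqP; rewrite -subr_eq0; apply/eqP.
pose S h := T i (A i h) - A i (T i h).
have lin : linear S.
  by move=> a x y; rewrite /S !linearP scalerDr addrACA.
apply: (dot_numrange0 (f := f) (S := HB.pack_for {linear H -> H} S
  (GRing.isLinear.Build _ _ _ _ S lin))) => x /=.
rewrite /S linearBl; apply/eqP; rewrite subr_eq0; apply/eqP.
by rewrite [LHS]TA [RHS]adjoint_opr (dot_sqr_eq (TN x)).
Qed.

End Coisometry.

Theorem mainTheorem12 (R : realType) (d : nat) (d_gt0 : (0 < d)%N)
    (H : completeNormedModType R[i]) (f : {dot H for conjC})
    (f_hilbert : hilbert_dot f) (T : 'I_d -> {linear H -> H})
    (T_crc : commuting_row_contraction f T)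
    (T_coiso : fully_coisometric f T) :
  spherical f T <->
  forall (m : nat) (eta : tpow d m R[i]^o) (h : H),
    (0 < m)%N -> sympow eta ->
    (fun l : nat => dnorm (tdot f (n := m + (l - m)))
       (symproj (tensor eta (rep_tilde_adj f T (l - m) h)))) @ \oo
      --> dnorm f (rep T eta h).
Proof.
have [_ TC _] := T_crc.
have [A [AE TA]] := coisometric_adjoint T_coiso.
have AC := adjoint_commute TC TA.
have Aiso := adjoint_isometric TC TA T_coiso.
have lim m (eta : tpow d m R[i]^o) h : (0 < m)%N ->
    (fun l : nat => dnorm (tdot f (n := m + (l - m)))
       (symproj (tensor eta (rep_tilde_adj f T (l - m) h)))) @ \oo
      --> dnorm f (dual_rep A eta h).
  move=> m0; under eq_fun do rewrite (rep_tilde_adjE TC TA).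
  exact: cvg_symproj_tensor.
rewrite (spherical_normalP TC TA T_coiso AE); split=> [TN m eta h m0 _|cvgT i].
  by rewrite (dnorm_rep_normal TC TA T_coiso _ _ TN); exact: lim.
apply: (normal_of_dnorm TA) => h.
(* The basis vector e_i, for which [rep] and [dual_rep] reduce to [T i] and [A i]. *)
pose eta : tpow d 1 R[i]^o :=
  [ffun w : {ffun 'I_1 -> 'I_d} => (w ord0 == i)%:R].
have repE : rep T eta h = T i h.
  rewrite /rep sum_word1 (bigD1 i) //= big1 => [|j ji].
    by rewrite !ffunE eqxx scale1r wordop1 addr0.
  by rewrite !ffunE (negPf ji) scale0r.
have dualE : dual_rep A eta h = A i h.
  rewrite /dual_rep sum_word1 (bigD1 i) //= big1 => [|j ji].
    by rewrite !ffunE eqxx conjC1 scale1r wordop1 addr0.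
  by rewrite !ffunE (negPf ji) conjC0 scale0r.
have cT := cvgT 1%N eta h isT (sympow1 eta); rewrite repE in cT.
have cA := lim 1%N eta h isT; rewrite dualE in cA.
(* Both norms are limits of one and the same sequence. *)
by rewrite -(cvg_lim (@Rhausdorff R) cT) -(cvg_lim (@Rhausdorff R) cA).
Qed.
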